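(* Suppose that the support $\mathcal S=\{a\in\mathcal A:p_a>0\}$ is infinite. Assume that, for some $\alpha\in[0,1]$ and some function $\ell$ slowly varying at $+\infty$, we have $\nu(\varepsilon)\le \varepsilon^{-\alpha}\ell(1/\varepsilon)$ for all $0<\varepsilon\le1$. Then, for all integers $n\ge 2$, all integers $0\le r\le n-1$ and all $\beta\in(0,1)$ with $\beta>2(\alpha-r)-1$, $$\mathbb E M_{n,r}\le c(r)\,n^{\alpha-1}\ell(n)+c_2(\alpha,\beta,r)\,n^{\alpha-\frac{1+\beta}{2}}\,\ell^{\circ}_{\beta}(n),$$ where $$c_2(\alpha,\beta,r)=\frac{4^{1+r}}{r!}\left(\frac{1+r}{2}\right)^{\frac{1+\beta}{2}+r-\alpha}\sqrt{\gamma(1+\beta+2(r-\alpha),1)} .$$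
   Context: $\mathcal A$ is an at most countable set and $P=\{p_a:a\in\mathcal A\}$ is a probability distribution on $\mathcal A$ ($p_a\in[0,1]$, $\sum_{a}p_a=1$). $X_1,\dots,X_n$ are i.i.d. $\mathcal A$-valued random variables with distribution $P$; $\xi_n(a)=\sum_{i=1}^n\mathbf 1\{X_i=a\}$. For $0\le r\le n$, $M_{n,r}=\sum_{a\in\mathcal A}p_a\mathbf 1\{\xi_n(a)=r\}$. The counting function of $P$ is $\nu(\varepsilon)=|\{a\in\mathcal A:p_a\ge\varepsilon\}|$. A (measurable) function $\ell:[0,+\infty)\to\mathbb R$ is slowly varying at $+\infty$ if $\ell(cx)/\ell(x)\to1$ as $x\to+\infty$ for every $c>0$. For $\beta\in(0,1)$ and $x\ge1$, $$\ell^{\circ}_\beta(x)=\sqrt{\int_{2x}^{+\infty}\frac{\ell(u)^2}{u^{2-\beta}}\,\mathrm du}.$$ The constant $c(r)$ is $c(0)=e^{-1}$ and $c(r)=e(1+r)/\sqrt{\pi}$ for $r\ge 1$. The lower incomplete Gamma function is $\gamma(t,x)=\int_0^x u^{t-1}e^{-u}\,\mathrm du$ for $t>0$, $x\ge0$. *)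

(* Defs.v *)
From mathcomp Require Export all_boot all_order all_algebra.
From mathcomp Require Export all_classical all_reals all_analysis.
Export Order.TTheory GRing.Theory Num.Theory.
Export numFieldNormedType.Exports.

Set Implicit Arguments.
Unset Strict Implicit.
Unset Printing Implicit Defensive.

Local Open Scope classical_set_scope.
Local Open Scope ring_scope.

Definition is_distribution (R : realType) (A : choiceType) (p : A -> R) : Prop :=
  (forall a, 0 <= p a <= 1) /\ (\esum_(a in [set: A]) (p a)%:E = 1)%E.

Definition dist_support (R : realType) (A : choiceType) (p : A -> R) : set A :=
  [set a | 0 < p a].

(* Extended-real valued: [counting] is +oo on infinite sets. *)
Definition counting_function (R : realType) (A : choiceType) (p : A -> R)
    (eps : R) : \bar R :=
  counting [set a | eps <= p a].

Definition mutually_independent (d dA : measure_display) (T : measurableType d)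
    (A : measurableType dA) (R : realType) (P : probability T R) (n : nat)
    (X : 'I_n -> {RV P >-> A}) : Prop :=
  forall (J : {set 'I_n}) (B : 'I_n -> set A),
    (forall i, measurable (B i)) ->
    (P (\bigcap_(i in [set` J]) (X i @^-1` B i))
     = \prod_(i in J) P (X i @^-1` B i))%E.

Definition iid_with_law (d dA : measure_display) (T : measurableType d)
    (A : measurableType dA) (R : realType) (P : probability T R) (n : nat)
    (X : 'I_n -> {RV P >-> A}) (p : A -> R) : Prop :=
  mutually_independent X /\
  (forall i a, distribution P (X i) [set a] = (p a)%:E).

Definition occupancy (T : Type) (A : eqType) (n : nat) (X : 'I_n -> T -> A)
    (a : A) (w : T) : nat :=
  (\sum_(i < n) (X i w == a))%N.

(* For a distribution [p] the sum is at most 1, so [fine] loses nothing. *)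
Definition occupancy_mass (R : realType) (T : Type) (A : choiceType)
    (p : A -> R) (n : nat) (X : 'I_n -> T -> A) (r : nat) (w : T) : R :=
  fine (\esum_(a in [set: A]) (p a * (occupancy X a w == r)%:R)%:E)%E.

(* Only the values of [l] on [0, +oo[ matter. Since x / 0 = 0, the limit forces
   [l] to be eventually nonzero. *)
Definition slowly_varying (R : realType) (l : R -> R) : Prop :=
  measurable_fun (`[0, +oo[%classic : set R) l /\
  (forall c : R, 0 < c -> l (c * x) / l x @[x --> +oo] --> (1 : R)).

(* A slowly varying function need not be square-integrable near a finite point,
   so the integral, hence its square root, may be +oo. *)
Definition ell_circ (R : realType) (l : R -> R) (beta x : R) : \bar R :=
  sqrte (\int[lebesgue_measure]_(u in `[(2 * x)%R, +oo[%classic : set R)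
           (l u ^+ 2 / u `^ (2 - beta))%:E)%E.

Definition lower_gamma (R : realType) (t x : R) : R :=
  \int[lebesgue_measure]_(u in `[0, x]) (u `^ (t - 1) * expR (- u)).

Definition c_r (R : realType) (r : nat) : R :=
  if r == 0%N then expR (- 1) else expR 1 * (1 + r%:R) / Num.sqrt pi.

Definition c2 (R : realType) (alpha beta : R) (r : nat) : R :=
  4 ^+ (1 + r) / r`!%:R
  * ((1 + r%:R) / 2) `^ ((1 + beta) / 2 + r%:R - alpha)
  * Num.sqrt (lower_gamma (1 + beta + 2 * (r%:R - alpha)) 1).

(* Main.v *)
Require Import Defs.
From mathcomp Require Import ring lra measurable_realfun.

(** Counting which trials draw a given atom, the expectation is the sum over the
    atoms of ['C(n, r) * p a ^+ r.+1 * (1 - p a) ^+ (n - r)]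
    ([expectation_occupancy_mass]). The atoms are separated at mass [1 / n].

    Above the threshold, each summand is at most [c_r R r / n]
    ([mass_term_le_c_r]): for [r = 0] because [y * expR (- y) <= expR (- 1)], and
    for positive [r] because the summand is [(r + 1) / (n + 1)] times a binomial
    probability. The number of these atoms is the counting function at [1 / n], at
    most [n `^ alpha * l n], which gives the first term of the bound.

    Below the threshold, the summand is at most [n ^ r / r`! * p a ^+ r.+1], and
    [p a ^+ r.+1 = 2 ^ (r + 1) * (r + 1) * \int_(2 / p a)^oo u ^ (- r - 2) du], an
    integral over a part of [[2 * n, +oo[]. Summing over the atoms under the integral
    sign replaces the constraint on [u] by the counting function at [1 / u], whence
    at most [n ^ r / r`! * 2 ^ (r + 1) * (r + 1)
    * \int_(2 * n)^oo u `^ (alpha - r - 2) * l u du]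
    ([esum_small_atoms_le]). Working with [u] in place of [1 / u] makes a change of
    variables in an integral of the merely measurable function [l] unnecessary.
    Cauchy-Schwarz separates [l] from the powers and brings out [ell_circ]; the
    remaining integral of [u `^ (- t - 1)], with
    [t = 1 + beta + 2 * (r - alpha) > 0], equals [(2 * n) `^ (- t) / t]
    ([tail_integral_le]). The constant so obtained is below the stated one because
    [1 / t <= 4 * lower_gamma t 1] and [2 * (r + 1) <= 2 ^ (r + 1)]
    ([constant_le]). *)

Set Implicit Arguments.
Unset Strict Implicit.
Unset Printing Implicit Defensive.

Local Open Scope classical_set_scope.
Local Open Scope ring_scope.

(** * Sums over countable types and the Cauchy-Schwarz inequality *)

(** A finite bound [m] rules out the infinite value of the counting measure, so
    the sum has finitely many nonzero terms, all equal to [c]. *)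
Lemma esum_indicator_le (R : realType) d (A : measurableType d) (B : set A)
    (c m : R) : 0 <= c -> (counting B <= m%:E)%E ->
  (\esum_(a in [set: A]) (c * (a \in B)%:R)%:E <= (c * m)%:E)%E.
Proof.
move=> c0; rewrite /counting; case: asboolP => [fB|_]; last by rewrite leye_eq.
rewrite lee_fin => Bm.
rewrite (esumID B)//; last by move=> a _; rewrite lee_fin mulr_ge0.
rewrite !setTI [X in (_ + X)%E]esum1 ?adde0; last first.
  by move=> a /= Ba; rewrite memNset// mulr0.
rewrite esum_fset//; last by move=> a _; rewrite lee_fin mulr_ge0.
rewrite fsbig_finite//= (eq_big_seq (fun=> c%:E)); last first.
  by move=> a; rewrite in_fset_set// => ->; rewrite mulr1.
rewrite sumEFin big_const_seq count_predT iter_addr_0 lee_fin -mulr_natr.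
by rewrite ler_wpM2l.
Qed.

Lemma infinite_countable_bij (A : pointedType) : countable [set: A] ->
  infinite_set [set: A] -> exists e : nat -> A, set_bij [set: nat] [set: A] e.
Proof.
move=> cA iA.
have := eq_card_nat cA iA; rewrite card_eq_sym => /card_set_bijP[e be].
by exists e.
Qed.

(** Tonelli's theorem for a counting measure against [mu]: enumerating the index
    type turns the sum into a series, to which monotone convergence applies. *)
Lemma integral_esum (R : realType) d (T : measurableType d)
    (mu : {measure set T -> \bar R}) (A : pointedType)
    (D : set T) (f : A -> T -> \bar R) :
  countable [set: A] -> infinite_set [set: A] ->
  measurable D ->
  (forall a, measurable_fun D (f a)) ->
  (forall a x, D x -> 0 <= f a x)%E ->
  (\int[mu]_(x in D) (\esum_(a in [set: A]) f a x) =
   \esum_(a in [set: A]) \int[mu]_(x in D) f a x)%E.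
Proof.
move=> cA iA mD mf f0; have [e be] := infinite_countable_bij cA iA.
rewrite (reindex_esum [set: nat] _ e)// -nneseries_esumT; last first.
  by move=> n; apply: integral_ge0 => x; exact: f0.
rewrite -integral_nneseries//; last by move=> n x; exact: f0.
apply: eq_integral => x /set_mem Dx.
by rewrite (reindex_esum [set: nat] _ e)// nneseries_esumT// => n; exact: f0.
Qed.

(** Hoelder's inequality with both exponents equal to 2, on the extensions of [f]
    and [g] by 0 outside [D]. The factors are extended real numbers, so that an
    infinite [ell_circ] is covered. *)
Lemma cauchy_schwarz (R : realType) d (T : measurableType d)
    (mu : {measure set T -> \bar R}) (D : set T) (f g : T -> R) :
  measurable D -> measurable_fun D f -> measurable_fun D g ->
  (forall x, D x -> 0 <= f x * g x) ->
  (\int[mu]_(x in D) (f x * g x)%:E <=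
   sqrte (\int[mu]_(x in D) (f x ^+ 2)%:E) *
   sqrte (\int[mu]_(x in D) (g x ^+ 2)%:E))%E.
Proof.
move=> mD mf mg fg0.
have mfD : measurable_fun setT (f \_ D).
  exact: (measurable_restrictT f mD).1.
have mgD : measurable_fun setT (g \_ D).
  exact: (measurable_restrictT g mD).1.
have norm2 (h : T -> R) : Lnorm mu 2%:E (EFin \o (h \_ D)) =
    sqrte (\int[mu]_(x in D) (h x ^+ 2)%:E).
  rewrite unlock /= poweR12_sqrt; last by apply: integral_ge0 => x _; rewrite lee_fin powR_ge0.
  congr sqrte; rewrite [RHS]integral_mkcond; apply: eq_integral => x _ /=.
  rewrite !patchE; case: ifPn => _ /=.
    by rewrite (powR_mulrn 2)// real_normK// num_real.
  by rewrite normr0 powR0.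
have := @hoelder _ _ _ mu _ _ 2 2 mfD mgD (ltr0Sn _ _) (ltr0Sn _ _).
rewrite !norm2 Lnorm1.
have half2 : 2^-1 + 2^-1 = 1 :> R by rewrite [RHS](splitr 1) !div1r.
move=> /(_ half2); apply: le_trans.
rewrite [leLHS]integral_mkcond.
rewrite le_eqVlt; apply/orP; left; apply/eqP; apply: eq_integral => x _ /=.
rewrite !patchE; case: ifPn => [/set_mem Dx|_]; last by rewrite mul0r normr0.
by rewrite ger0_norm// fg0.
Qed.

(** * Pointwise bounds for binomial weights *)

(** It is one of the nonnegative terms of the expansion of [((1 - x) + x) ^+ n]. *)
Lemma binomial_term_le1 (R : realFieldType) (n r : nat) (x : R) : 0 <= x <= 1 ->
  'C(n, r)%:R * (x ^+ r * (1 - x) ^+ (n - r)) <= 1.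
Proof.
move=> /andP[x0 x1].
have [nr|rn] := ltnP n r; first by rewrite bin_small// mul0r.
rewrite [leRHS](_ : 1 = ((1 - x) + x) ^+ n); last by rewrite subrK expr1n.
rewrite [leRHS]exprDn (bigD1 (Ordinal (rn : (r < n.+1)%N)))//= mulr_natl [x ^+ r * _]mulrC.
rewrite lerDl; apply: sumr_ge0 => i _.
by rewrite mulrn_wge0// mulr_ge0 ?exprn_ge0// subr_ge0.
Qed.

(** Since ['C(n, r) = (r + 1) / (n + 1) * 'C(n + 1, r + 1)], the left-hand side is
    [(r + 1) / (n + 1)] times a probability of the binomial law with [n + 1]
    trials. *)
Lemma mass_term_le (R : realFieldType) (n r : nat) (x : R) : 0 <= x <= 1 ->
  (r <= n)%N -> (0 < n)%N ->
  'C(n, r)%:R * (x ^+ r.+1 * (1 - x) ^+ (n - r)) <= (1 + r%:R) / n%:R.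
Proof.
move=> x01 rn n0.
have n1 : (0 : R) < n.+1%:R by rewrite ltr0n.
have nn : (0 : R) < n%:R by rewrite ltr0n.
have E : ('C(n, r)%:R : R) = r.+1%:R / n.+1%:R * 'C(n.+1, r.+1)%:R.
  apply: (mulfI (lt0r_neq0 n1)).
  rewrite -natrM mul_bin_diag natrM mulrA mulrCA; field.
  by rewrite lt0r_neq0.
rewrite E -(mulrA (_ / _)) -(subSS r n).
apply: (@le_trans _ _ (r.+1%:R / n.+1%:R)).
  by rewrite ler_piMr ?binomial_term_le1// divr_ge0.
rewrite -[1 + _](natrD _ 1 r) add1n ler_wpM2l// lef_pV2 ?posrE// ler_nat//.
Qed.

(** From [1 - x <= expR (- x)], and [y * expR (- y) <= expR (- 1)] at
    [y = x * n%:R]. *)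
Lemma mass_term0_le (R : realType) (n : nat) (x : R) : 0 <= x <= 1 ->
  (0 < n)%N -> x * (1 - x) ^+ n <= expR (- 1) / n%:R.
Proof.
move=> /andP[x0 x1] n0.
have nn : (0 : R) < n%:R by rewrite ltr0n.
rewrite ler_pdivlMr//.
apply: (@le_trans _ _ (x * n%:R * expR (- (x * n%:R)))).
  rewrite mulrAC ler_wpM2l ?mulr_ge0//.
  rewrite -mulNr -[- x * _]mulrC expRM_natl lerXn2r ?nnegrE ?expR_ge0 ?subr_ge0//.
  exact: expR_ge1Dx.
have := expR_ge1Dx (x * n%:R - 1); rewrite subrKC => /(ler_wpM2r (expR_ge0 (- (x * n%:R)))).
by rewrite -expRD addrAC subrr add0r.
Qed.

(** It suffices that [Num.sqrt pi <= 2 <= expR 1], which follows from [pi < 4]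
    and [1 + x <= expR x]. *)
Lemma c_r_ge (R : realType) (r : nat) : (0 < r)%N -> 1 + r%:R <= c_r R r.
Proof.
move=> r0; rewrite /c_r gt_eqF//.
have pi0 := pi_gt0 R.
rewrite ler_pdivlMr ?sqrtr_gt0// mulrC ler_wpM2r//.
apply: (@le_trans _ _ 2); last exact: expR_ge1Dx.
rewrite -[leRHS]ger0_norm// -sqrtr_sqr ler_wsqrtr//.
have := pihalf_lt2 R; lra.
Qed.

Lemma mass_term_le_c_r (R : realType) (n r : nat) (x : R) : 0 <= x <= 1 ->
  (r <= n)%N -> (0 < n)%N ->
  'C(n, r)%:R * (x ^+ r.+1 * (1 - x) ^+ (n - r)) <= c_r R r / n%:R.
Proof.
move=> x01 rn n0; case: r rn => [_|r rn].
  by rewrite bin0 mul1r expr1 subn0 mass_term0_le.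
apply: (le_trans (mass_term_le x01 rn n0)).
by rewrite ler_wpM2r// c_r_ge.
Qed.

Lemma bin_le_exp (R : realFieldType) (n r : nat) : 'C(n, r)%:R <= n%:R ^+ r / r`!%:R :> R.
Proof.
rewrite ler_pdivlMr ?ltr0n ?fact_gt0// -natrM bin_ffact -natrX ler_nat.
rewrite ffact_prod -[X in (n ^ X)%N]card_ord -prod_nat_const.
by apply: leq_prod => i _; exact: leq_subr.
Qed.

(** * Integrals of powers and the incomplete Gamma function *)

Lemma powRN_cvg0 (R : realType) (s : R) : 0 < s ->
  x `^ (- s) @[x --> +oo] --> (0 : R).
Proof.
move=> s0.
apply/cvgrPdist_le => /= e e0; near=> x.
pose c := e `^ (- s^-1).
have cx : c <= x by near: x; apply: nbhs_pinfty_ge; rewrite num_real.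
have c0 : 0 < c by rewrite powR_gt0.
have <- : c `^ (- s) = e by rewrite -powRrM mulrNN mulVf ?gt_eqF// powRr1// ltW.
have x0 : 0 < x := lt_le_trans c0 cx.
rewrite sub0r normrN ger0_norm ?powR_ge0// !powRN lef_pV2 ?posrE ?powR_gt0//.
by apply: ge0_ler_powR; rewrite ?nnegrE ?(ltW s0) ?(ltW c0) ?(ltW x0).
Unshelve. all: by end_near. Qed.

Lemma continuous_powR_pos (R : realType) (s x : R) : 0 < x ->
  {for x, continuous (fun u : R => u `^ s)}.
Proof.
move=> x0; apply: differentiable_continuous; apply/derivable1_diffP.
by apply: derivable_powR; rewrite in_itv/= x0.
Qed.

Lemma integral_powR_itvy (R : realType) (a s : R) : 0 < a -> 0 < s ->
  (\int[lebesgue_measure]_(u in `[a, +oo[%classic) (u `^ (- s - 1))%:E =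
   (a `^ (- s) / s)%:E)%E.
Proof.
move=> a0 s0.
have s00 : s != 0 by rewrite gt_eqF.
pose F := fun u : R => (- s^-1) * u `^ (- s).
rewrite (@ge0_continuous_FTC2y _ _ F _ 0).
- by rewrite /F -EFinB sub0r mulNr opprK mulrC.
- by move=> x _; exact: powR_ge0.
- apply/continuous_within_itvcyP; split.
    move=> x; rewrite in_itv/= andbT => ax.
    by apply: continuous_powR_pos; exact: lt_trans ax.
  apply: cvg_at_right_filter; exact: continuous_powR_pos.
- rewrite /F -[X in _ --> X](mulr0 (- s^-1)).
  by apply: cvgMr; exact: powRN_cvg0.
- move=> x ax; apply: derivableM => //.
  by apply: derivable_powR; rewrite in_itv/= (lt_trans a0).
- apply: cvg_at_right_filter; apply: cvgM; first exact: cvg_cst.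
  exact: continuous_powR_pos.
- move=> x; rewrite in_itv/= andbT => ax.
  have x0 : 0 < x := lt_trans a0 ax.
  rewrite derive1E deriveM//; last by apply: derivable_powR; rewrite in_itv/= x0.
  rewrite derive_cst scaler0 addr0 -derive1E powR_derive1 ?in_itv/= ?x0//.
  rewrite /GRing.scale/=; by field.
Qed.

(** Bounding [expR (- u)] below by [expR (- 1)] compares the Gamma integral with
    [t^-1 * expR (- 1)], and [expR (- 1)] exceeds [1 / 4]. The upper
    bound serves the finiteness of the integral, for [lower_gamma] is the [fine] part of
    an extended real number and would be 0 if that number were infinite. *)
Lemma lower_gamma_ge (R : realType) (t : R) : 0 < t ->
  t^-1 <= 4 * lower_gamma t 1.
Proof.
move=> t0.
pose g := fun u : R => u `^ (t - 1) * expR (- u).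
have mg D : measurable D -> measurable_fun D g.
  move=> mD; apply: measurable_funTS; apply: measurable_funM => //.
  by apply: measurableT_comp => //.
have g0 u : 0 <= g u by rewrite mulr_ge0 ?powR_ge0 ?expR_ge0.
have I (e : R) : 0 < e -> e < 1 ->
  (\int[lebesgue_measure]_(u in `[e, 1%R]) (u `^ (t - 1))%:E = ((1 - e `^ t) / t)%:E)%E.
  move=> e0 e1; pose F := fun u : R => t^-1 * u `^ t.
  rewrite (@continuous_FTC2 _ _ F e 1)//.
  - by rewrite -EFinB /F powR1 -mulrBr mulrC.
  - apply/continuous_within_itvP => //; split.
    + move=> x; rewrite in_itv/= => /andP[ex _].
      by apply: continuous_powR_pos; exact: lt_trans ex.
    + by apply: cvg_at_right_filter; exact: continuous_powR_pos.
    + by apply: cvg_at_left_filter; exact: continuous_powR_pos.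
  - split.
    + move=> x; rewrite in_itv/= => /andP[ex _]; apply: derivableM => //.
      by apply: derivable_powR; rewrite in_itv/= (lt_trans e0).
    + apply: cvg_at_right_filter; apply: cvgM; first exact: cvg_cst.
      exact: continuous_powR_pos.
    + apply: cvg_at_left_filter; apply: cvgM; first exact: cvg_cst.
      exact: continuous_powR_pos.
  - move=> x; rewrite in_itv/= => /andP[ax _].
    have x0 : 0 < x := lt_trans e0 ax.
    rewrite derive1E deriveM//; last by apply: derivable_powR; rewrite in_itv/= x0.
    rewrite derive_cst scaler0 addr0 -derive1E powR_derive1 ?in_itv/= ?x0//.
    rewrite /GRing.scale/=; field.
  by rewrite gt_eqF.
have mup : measurable_fun setT (fun u : R => (u `^ (t - 1))%:E).
  by apply/measurable_EFinP; exact: measurable_powR.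
have mgE D : measurable D -> measurable_fun D (EFin \o g).
  by move=> mD; apply/measurable_EFinP; exact: mg.
pose G := (\int[lebesgue_measure]_(u in `[0%R, 1%R]) (g u)%:E)%E.
have G_ge0 : (0 <= G)%E by apply: integral_ge0 => u _; rewrite lee_fin.
(* Exhausting ]0, 1] by compact intervals avoids the singularity at 0, where the
   fundamental theorem of calculus does not apply when t < 1. *)
have G_le : (G <= (t^-1)%:E)%E.
  rewrite /G -integral_itv_obnd_cbnd; last exact: mgE.
  pose F (k : nat) : set R := `[k.+2%:R^-1, 1%R]%classic.
  have F0 k : (0 : R) < k.+2%:R^-1 by rewrite invr_gt0.
  have F1 k : (k.+2%:R^-1 : R) < 1 by rewrite invf_lt1// ltr1n.
  have nF : nondecreasing_seq F.
    apply/nondecreasing_seqP => k; apply/subsetPset; apply: subset_itvr.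
    by rewrite bnd_simp lef_pV2 ?posrE// ler_nat.
  have FU : `]0%R, 1%R]%classic = \bigcup_k F k.
    apply/seteqP; split => [u|u [k _]]; rewrite /F/= !in_itv/= => /andP[u0 u1].
      have [k ku] : exists k : nat, u^-1 <= k.+2%:R.
        exists (Num.bound u^-1); apply: ltW.
        apply: (lt_le_trans (archi_boundP _)); first by rewrite invr_ge0 ltW.
        by rewrite ler_nat leqW.
      exists k => //; rewrite /F/= in_itv/= u1 andbT.
      by rewrite -[leRHS]invrK lef_pV2 ?posrE ?invr_gt0.
    by rewrite u1 (lt_le_trans (F0 k)).
  rewrite FU.
  have cG := @ge0_nondecreasing_set_cvg_integral _ (measurableTypeR R) R F (EFin \o g)
    lebesgue_measure nF (fun k => measurable_itv _)
    (fun k => mgE _ (measurable_itv _)) (fun k u _ => g0 u).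
  rewrite -(cvg_lim _ cG)//; apply: lime_le; first by apply/cvg_ex; eexists; exact: cG.
  apply: nearW => k.
  apply: (@le_trans _ _ (\int[lebesgue_measure]_(u in F k) (u `^ (t - 1))%:E)%E).
    apply: ge0_le_integral => //.
    - exact: measurable_itv.
    - by move=> u _ /=; rewrite lee_fin.
    - apply: mgE; exact: measurable_itv.
    - exact: measurable_funTS.
    - move=> u; rewrite /F/= in_itv/= => /andP[u0 _]; rewrite lee_fin.
      rewrite ler_piMr ?powR_ge0// -expR0 ler_expR oppr_le0.
      by rewrite (le_trans _ u0)// ltW.
  rewrite I// lee_fin ler_pdivrMr// mulVf ?gt_eqF// gerBl powR_ge0//.
(* Cutting at e, with e `^ t = 1 / 16, leaves 15 / 16 of the integral of
   u `^ (t - 1), and 8 / 27 * 15 / 16 = 5 / 18 > 1 / 4. *)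
have G_ge : ((5 / 18 / t)%:E <= G)%E.
  pose e : R := 16^-1 `^ t^-1.
  have e0 : 0 < e by rewrite powR_gt0.
  have et : e `^ t = 16^-1 by rewrite -powRrM mulVf ?gt_eqF// powRr1.
  have e1 : e < 1.
    rewrite ltNge; apply/negP => e1.
    have : 1 <= e `^ t by rewrite -(powRr0 e) ler_powR// ltW.
    by rewrite et; lra.
  apply: (@le_trans _ _ (\int[lebesgue_measure]_(u in `[e, 1%R]) (g u)%:E)%E); last first.
    apply: ge0_subset_integral => //; first exact: mgE.
    - by move=> u _; rewrite lee_fin.
    - by apply: subset_itvr; rewrite bnd_simp ltW.
  (* 8 / 27 is (1 - 1 / 3) ^ 3, and 1 - 1 / 3 <= expR (- 1 / 3). *)
  have e827 : (8 / 27 : R) <= expR (- 1).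
    have -> : (- 1 : R) = 3%:R * (- 3^-1) by field.
    rewrite expRM_natl (_ : 8 / 27 = (1 + - 3^-1) ^+ 3); last by field.
    by rewrite lerXn2r ?nnegrE ?expR_ge0 ?expR_ge1Dx//; lra.
  apply: (@le_trans _ _ (\int[lebesgue_measure]_(u in `[e, 1%R])
      ((8 / 27)%:E * (u `^ (t - 1))%:E))%E).
    rewrite ge0_integralZl_EFin//; last 2 first.
    - by move=> u _; rewrite lee_fin powR_ge0.
    - exact: measurable_funTS.
    rewrite I// et -EFinM lee_fin [leRHS](_ : _ = 5 / 18 / t)//.
    by field; rewrite gt_eqF.
  apply: ge0_le_integral => //.
  - by move=> u _; rewrite -EFinM lee_fin mulr_ge0 ?powR_ge0//; lra.
  - by apply: measurable_funTS; apply: emeasurable_funM.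
  - exact: mgE.
  - move=> u /=; rewrite in_itv/= => /andP[_ u1].
    rewrite -EFinM lee_fin mulrC ler_wpM2l ?powR_ge0//.
    by rewrite (le_trans e827)// ler_expR lerN2.
have Gf : G \is a fin_num by rewrite ge0_fin_numE// (le_lt_trans G_le)// ltry.
rewrite -lee_fin /lower_gamma /Rintegral EFinM -/G fineK//.
have : ((4 * (5 / 18 / t))%:E <= 4%:E * G)%E by rewrite EFinM lee_wpmul2l// lee_fin.
apply: le_trans; rewrite lee_fin -[leLHS]mul1r.
rewrite mulrA ler_wpM2r ?invr_ge0 ?ltW//; lra.
Qed.

(** * Occupancy counts of an i.i.d. sample *)

Section Occupancy.
Context (R : realType) (dA d : measure_display)
    (A : measurableType dA) (A_discrete : forall B : set A, measurable B)
    (p : A -> R) (T : measurableType d) (P : probability T R) (n : nat)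
    (X : 'I_n -> {RV P >-> A}) (X_iid : iid_with_law X p).

Definition hits (a : A) (J : {set 'I_n}) (i : 'I_n) : set A :=
  if i \in J then [set a] else ~` [set a].

(** The intersection is over all trials, also those outside [J], in the form to which
    mutual independence applies. *)
Definition hit_event a J : set T :=
  \bigcap_(i in [set` [set: 'I_n]%SET]) (X i @^-1` hits a J i).

Lemma prob_hits a J i :
  P (X i @^-1` hits a J i) = (if i \in J then p a else 1 - p a)%:E.
Proof.
have [_ law] := X_iid.
have := law i a; rewrite /distribution /pushforward /= => Pa.
rewrite /hits; case: ifPn => // _.
by rewrite -preimage_setC probability_setC ?Pa//; exact: measurable_funPTI.
Qed.

Lemma prob_hit_event a J :
  P (hit_event a J) = (p a ^+ #|J| * (1 - p a) ^+ (n - #|J|))%:E.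
Proof.
have [ind _] := X_iid.
rewrite /hit_event ind//.
under eq_bigr do rewrite prob_hits.
rewrite prodEFin; congr EFin.
rewrite (eq_bigl xpredT); last by move=> i; rewrite inE.
rewrite (bigID (mem J))/= (eq_bigr (fun=> p a)); last by move=> i ->.
rewrite prodr_const; congr (_ * _).
rewrite (eq_bigr (fun=> 1 - p a)); last by move=> i /negbTE ->.
rewrite (eq_bigl (mem (~: J)%SET)); last by move=> i; rewrite /= !inE.
by rewrite prodr_const -[X in (X - _)%N](card_ord n) -(cardsC J) addKn.
Qed.

Lemma measurable_hit_event a J : measurable (hit_event a J).
Proof.
by apply: fin_bigcap_measurable => // i _; exact: measurable_funPTI.
Qed.

Lemma hit_eventP a J w : hit_event a J w <-> J = [set i | X i w == a]%SET.
Proof.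
rewrite /hit_event /hits; split=> [wJ|-> i _ /=]; last first.
  by rewrite inE; case: ifPn => [/eqP|/eqP].
apply/setP => i; rewrite inE; have /= := wJ i.
rewrite finset.in_setT => /(_ isT); case: ifPn => _ /= Xia; first by rewrite Xia eqxx.
by apply/esym/eqP.
Qed.

Lemma occupancyE a w : occupancy X a w = #|[set i | X i w == a]%SET|.
Proof.
rewrite /occupancy -sum1dep_card [RHS]big_mkcond.
by apply: eq_bigr => i _; case: eqP.
Qed.

Lemma occupancy_hit_event a r :
  [set w | occupancy X a w = r] =
  \bigcup_(J in [set` enum [set J : {set 'I_n} | #|J| == r]%SET]) hit_event a J.
Proof.
apply/seteqP; split=> [w /= wr|w [J /=]].
  exists [set i | X i w == a]%SET; last exact/hit_eventP.
  by rewrite /= mem_enum inE -occupancyE wr.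
by rewrite mem_enum inE => /eqP <- /hit_eventP ->; rewrite occupancyE.
Qed.

Lemma measurable_occupancy a r : measurable [set w | occupancy X a w = r].
Proof.
rewrite occupancy_hit_event; apply: fin_bigcup_measurable => // J _.
exact: measurable_hit_event.
Qed.

(** The binomial law: one disjoint event for each set of [r] trials. *)
Lemma prob_occupancy a r :
  P [set w | occupancy X a w = r] =
  ('C(n, r)%:R * (p a ^+ r * (1 - p a) ^+ (n - r)))%:E.
Proof.
rewrite occupancy_hit_event measure_fin_bigcup//; last 2 first.
- by move=> J K _ _ [w [/hit_eventP -> /hit_eventP ->]].
- by move=> J _; exact: measurable_hit_event.
rewrite -fsbig_seq ?enum_uniq//.
rewrite (eq_big_seq (fun=> (p a ^+ r * (1 - p a) ^+ (n - r))%:E)); last first.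
  by move=> J; rewrite mem_enum inE => /eqP <-; exact: prob_hit_event.
rewrite sumEFin big_const_seq count_predT iter_addr_0 -cardE card_draws card_ord.
by rewrite mulr_natl.
Qed.

(** Tonelli exchanges the expectation with the sum over the atoms. The random
    missing mass is a finite number because it is at most the total mass 1. *)
Lemma expectation_occupancy_mass r :
  countable [set: A] -> infinite_set [set: A] -> is_distribution p ->
  ('E_P[occupancy_mass p X r] =
   \esum_(a in [set: A])
    ('C(n, r)%:R * (p a ^+ r.+1 * (1 - p a) ^+ (n - r)))%:E)%E.
Proof.
move=> A_countable A_infinite [p01 p1].
have p0 a : 0 <= p a by have /andP[] := p01 a.
have mass_fin w : (\esum_(a in [set: A]) (p a * (occupancy X a w == r)%:R)%:E)%E
    \is a fin_num.
  rewrite ge0_fin_numE; last by apply: esum_ge0 => a _; rewrite lee_fin mulr_ge0.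
  apply: (@le_lt_trans _ _ 1%E); last exact: ltry.
  rewrite -p1; apply: le_esum => a _; rewrite lee_fin.
  by rewrite ler_piMr// lern1 leq_b1.
have term w a : (p a * (occupancy X a w == r)%:R)%:E =
    ((p a)%:E * (\1_[set w | occupancy X a w = r] w)%:E)%E.
  rewrite -EFinM indicE; congr (_ * (nat_of_bool _)%:R)%:E.
  by apply/eqP/idP => [oar|/set_mem//]; exact: mem_set.
rewrite unlock; under eq_integral do rewrite fineK//.
rewrite integral_esum//; last 2 first.
- move=> a; under eq_fun do rewrite term.
  apply: emeasurable_funM => //; apply/measurable_EFinP.
  by apply: measurable_indic; exact: measurable_occupancy.
- by move=> a w _; rewrite lee_fin mulr_ge0.
apply: eq_esum => a _; under eq_integral do rewrite term.
have mo := measurable_occupancy a r.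
rewrite ge0_integralZl_EFin//; last by apply/measurable_EFinP; exact: measurable_indic.
rewrite integral_indic// setIT [X in (_ * X)%E]prob_occupancy -EFinM; congr EFin.
by rewrite exprS; ring.
Qed.
End Occupancy.

(** * The contribution of the small atoms *)

(** For positive [q] the integral of the integrand without its boolean factor over
    [[2 / q, +oo[] equals
    [b * q ^+ r.+1], and that half-line lies inside the domain because [q < c^-1].
    Starting at [2 / q], not [1 / q], is what produces the lower limit [2 * c];
    the constraint [1 <= q * u] is weaker than [2 <= q * u], and it is the one that
    the counting function evaluates at [1 / u]. *)
Lemma expr_le_tail_integral (R : realType) (r : nat) (b c q : R) :
  0 <= b -> 0 < c -> 0 <= q -> q < c^-1 ->
  ((b * q ^+ r.+1)%:E <= \int[lebesgue_measure]_(u in `[(2 * c)%R, +oo[%classic)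
     (b * (2 ^+ r.+1 * r.+1%:R) * u `^ (- r.+1%:R - 1) * (1 <= q * u)%R%:R)%:E)%E.
Proof.
move=> b0 c0 q0 qc; set K : R := b * (_ * r.+1%:R).
have K0 : 0 <= K by rewrite !mulr_ge0 ?exprn_ge0.
have [->|qn0] := eqVneq q 0.
  rewrite expr0n/= mulr0; apply: integral_ge0 => u _.
  by rewrite lee_fin !mulr_ge0 ?powR_ge0.
have {qn0}q0 : 0 < q by rewrite lt_neqAle eq_sym qn0.
have cq : c < q^-1 by rewrite -(invrK c) ltf_pV2 ?posrE ?invr_gt0.
have q20 : 0 < 2 / q by rewrite divr_gt0.
have r0 : (0 : R) < r.+1%:R by [].
have := integral_powR_itvy q20 r0.
move=> /(congr1 (fun x => K%:E * x)%E).
have mp : measurable_fun setT (fun u : R => u `^ (- r.+1%:R - 1)) by exact: measurable_powR.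
rewrite -ge0_integralZl_EFin//; last 2 first.
- by move=> u _; rewrite lee_fin powR_ge0.
- by apply/measurable_EFinP; exact: measurable_funTS.
rewrite -EFinM (_ : K * _ = b * q ^+ r.+1); last first.
  rewrite powRN powR_mulrn ?ltW// /K expr_div_n invf_div; field.
  by rewrite nat1r pnatr_eq0 expf_neq0// pnatr_eq0.
move=> <-.
set h := fun u : R => (K * u `^ _ * (1 <= q * u)%R%:R)%:E.
have mh : measurable_fun setT h.
  apply/measurable_EFinP; apply: measurable_funM; first exact: measurable_funM.
  have mb : measurable_fun setT (fun b : bool => b%:R : R) by [].
  apply: measurableT_comp => //.
  exact: measurable_fun_ler.
have h0 u : (0 <= h u)%E by rewrite lee_fin !mulr_ge0 ?powR_ge0.
apply: (@le_trans _ _ (\int[lebesgue_measure]_(u in `[(2 / q)%R, +oo[%classic) h u)%E).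
  rewrite le_eqVlt; apply/orP; left; apply/eqP; apply: eq_integral => u.
  rewrite inE/= in_itv/= andbT => qu.
  rewrite -EFinM /h (_ : (1 <= q * u)%R) ?mulr1// mulrC -ler_pdivrMr//.
  by apply: le_trans qu; rewrite ler_wpM2r ?invr_ge0 ?ler1n ?ltW.
apply: ge0_subset_integral => //; first exact: measurable_funTS.
by apply: subset_itvr; rewrite bnd_simp ler_pM2l// ltW.
Qed.

(** Each small atom is written as an integral in [u], and summing the constraints
    [1 / u <= p a] under the integral sign gives the counting function at
    [1 / u], bounded by [u `^ alpha * l u]. *)
Lemma esum_small_atoms_le (R : realType) (dA : measure_display) (A : measurableType dA)
    (p : A -> R) (alpha : R) (l : R -> R) (b c : R) (r : nat) :
  countable [set: A] -> infinite_set [set: A] ->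
  (forall a, 0 <= p a) ->
  measurable_fun (`[0, +oo[%classic : set R) l ->
  (forall eps : R, 0 < eps <= 1 ->
      (counting_function p eps <= (eps `^ (- alpha) * l (1 / eps))%:E)%E) ->
  0 <= b -> 1 <= c ->
  (\esum_(a in [set: A]) (if (p a < c^-1)%R then b * p a ^+ r.+1 else 0)%:E <=
   \int[lebesgue_measure]_(u in `[(2 * c)%R, +oo[%classic)
     (b * (2 ^+ r.+1 * r.+1%:R) * u `^ (- r.+1%:R - 1) * (u `^ alpha * l u))%:E)%E.
Proof.
move=> cA iA p0 ml nu_le b0 c1.
have c0 : 0 < c by exact: lt_le_trans c1.
set K : R := b * (_ * r.+1%:R).
have K0 : 0 <= K by rewrite !mulr_ge0 ?exprn_ge0.
set D := `[(2 * c)%R, +oo[%classic.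
have mp s : measurable_fun setT (fun u : R => u `^ s) by exact: measurable_powR.
pose h a u := (K * u `^ (- r.+1%:R - 1) * (1 <= p a * u)%R%:R)%:E.
have h0 a u : (0 <= h a u)%E by rewrite lee_fin !mulr_ge0 ?powR_ge0.
have mh a : measurable_fun setT (h a).
  apply/measurable_EFinP; apply: measurable_funM; first exact: measurable_funM.
  have mb : measurable_fun setT (fun b : bool => b%:R : R) by [].
  by apply: measurableT_comp => //; exact: measurable_fun_ler.
have key u : D u -> ((\esum_(a in [set: A]) h a u) <=
    (K * u `^ (- r.+1%:R - 1) * (u `^ alpha * l u))%:E)%E.
  rewrite /D/= in_itv/= andbT => Du.
  have u1 : 1 <= u by lra.
  have u0 : 0 < u by lra.
  rewrite (_ : (fun a => h a u) = fun a => (K * u `^ (- r.+1%:R - 1) *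
    (a \in [set a | u^-1 <= p a])%:R)%:E); last first.
    apply/funext => a; congr (_ * (nat_of_bool _)%:R)%:E.
    rewrite -ler_pdivrMr// div1r.
    by apply/idP/idP => [ua|/set_mem//]; exact: mem_set.
  apply: esum_indicator_le; first by rewrite mulr_ge0 ?powR_ge0.
  have := nu_le u^-1; rewrite invr_gt0 u0 invf_le1// => /(_ u1).
  have -> : u^-1 `^ (- alpha) = u `^ alpha.
    by rewrite -(powR_inv1 (ltW u0)) -powRrM mulN1r opprK.
  by rewrite div1r invrK.
apply: (@le_trans _ _ (\esum_(a in [set: A]) \int[lebesgue_measure]_(u in D) h a u)%E).
  apply: le_esum => a _; case: ifPn => pa; first exact: expr_le_tail_integral.
  exact: integral_ge0.
rewrite -integral_esum//; last 2 first.
- exact: measurable_itv.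
- by move=> a; apply: measurable_funTS; exact: mh.
have [e be] := infinite_countable_bij cA iA.
apply: ge0_le_integral => //.
- exact: measurable_itv.
- by move=> u _; exact: esum_ge0.
- rewrite (_ : (fun u => _) = fun u => (\sum_(k <oo) h (e k) u)%E).
    by apply: ge0_emeasurable_sum => // k _; apply: measurable_funTS; exact: mh.
  apply/funext => u; rewrite nneseries_esumT//.
  by rewrite (reindex_esum [set: nat] _ e).
- apply/measurable_EFinP; apply: measurable_funM.
    by apply: measurable_funTS; exact: measurable_funM.
  apply: measurable_funM; first exact: measurable_funTS.
  apply: measurable_funS ml => //.
  by apply: subset_itvr; rewrite bnd_simp; lra.
Qed.

(** Cauchy-Schwarz with the splitting of [u `^ (alpha - r - 2) * l u] into
    [u `^ (- (t + 1) / 2)] and [l u * u `^ (- (2 - beta) / 2)], where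
    [t = 1 + beta + 2 * (r - alpha)]: the second square is the integrand of
    [ell_circ], the first one is an explicit convergent integral. *)
Lemma tail_integral_le (R : realType) (alpha beta : R) (l : R -> R) (c K : R) (r : nat) :
  measurable_fun (`[0, +oo[%classic : set R) l ->
  (forall u, 1 <= u -> 0 <= l u) ->
  1 <= c -> 0 <= K -> 0 < 1 + beta + 2 * (r%:R - alpha) ->
  (\int[lebesgue_measure]_(u in `[(2 * c)%R, +oo[%classic)
     (K * u `^ (- r.+1%:R - 1) * (u `^ alpha * l u))%:E <=
   (K * Num.sqrt ((2 * c) `^ (- (1 + beta + 2 * (r%:R - alpha))) /
      (1 + beta + 2 * (r%:R - alpha))))%:E * ell_circ l beta c)%E.
Proof.
move=> ml l0 c1 K0; set t := 1 + beta + _ => t0.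
set D := `[(2 * c)%R, +oo[%classic.
have mp s : measurable_fun D (fun u : R => u `^ s).
  by apply: measurable_funTS; exact: measurable_powR.
have mlD : measurable_fun D l.
  apply: measurable_funS ml => //.
  by apply: subset_itvr; rewrite bnd_simp; lra.
have D1 u : D u -> 1 <= u by rewrite /D/= in_itv/= andbT; lra.
pose f u := u `^ (- (t + 1) / 2) : R.
pose g u := l u * u `^ (- (2 - beta) / 2) : R.
have mg : measurable_fun D g by exact: measurable_funM.
have fg0 u : D u -> 0 <= f u * g u.
  by move=> /D1 u1; rewrite !mulr_ge0 ?powR_ge0// l0.
rewrite (_ : (\int[_]_(u in _) _)%E =
    (\int[lebesgue_measure]_(u in D) (K%:E * (f u * g u)%:E))%E); last first.
  apply: eq_integral => u /set_mem/D1 u1; rewrite -EFinM; congr EFin.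
  have u0 : u != 0 by rewrite gt_eqF//; lra.
  have E : u `^ (- r.+1%:R - 1) * u `^ alpha =
      u `^ (- (t + 1) / 2) * u `^ (- (2 - beta) / 2).
    rewrite -!powRD ?u0 ?implybT//; congr (_ `^ _).
    by rewrite /t -natr1; field.
  rewrite /f /g mulrA -[K * _ * _]mulrA E; ring.
rewrite ge0_integralZl_EFin//; last 2 first.
- exact: measurable_itv.
- by apply/measurable_EFinP; apply: measurable_funM => //; exact: mp.
rewrite EFinM -muleA; apply: lee_wpmul2l; first by rewrite lee_fin.
have mf : measurable_fun D f by exact: mp.
have mD : measurable (D : set (measurableTypeR R)) by exact: measurable_itv.
apply: (le_trans (cauchy_schwarz lebesgue_measure mD mf mg fg0)).
rewrite -[(Num.sqrt _)%:E]/(sqrte _%:E) -integral_powR_itvy//; last lra.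
rewrite le_eqVlt; apply/orP; left; apply/eqP.
congr (sqrte _ * sqrte _)%E; apply: eq_integral => u _; congr EFin.
  rewrite /f -powR_mulrn ?powR_ge0// -powRrM; congr (_ `^ _).
  by field.
rewrite /g exprMn -powRN; congr (_ * _).
rewrite -powR_mulrn ?powR_ge0// -powRrM; congr (_ `^ _).
by field.
Qed.

(** With [t = 1 + beta + 2 * (r - alpha)], both sides carry the power
    [n `^ (r - t / 2)]. What remains is [1 / t <= 4 * lower_gamma t 1],
    [2 `^ (- t / 2) <= ((1 + r) / 2) `^ (t / 2)] and
    [2 * (r + 1) <= 2 ^ (r + 1)]. *)
Lemma constant_le (R : realType) (alpha beta : R) (n r : nat) :
  (0 < n)%N -> 0 < 1 + beta + 2 * (r%:R - alpha) ->
  n%:R ^+ r / r`!%:R * (2 ^+ r.+1 * r.+1%:R) *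
    Num.sqrt ((2 * n%:R) `^ (- (1 + beta + 2 * (r%:R - alpha))) /
      (1 + beta + 2 * (r%:R - alpha))) <=
  c2 alpha beta r * n%:R `^ (alpha - (1 + beta) / 2).
Proof.
move=> n0; rewrite /c2; set t := 1 + beta + _ => t0.
set G := lower_gamma t 1.
have n1 : (0 : R) < n%:R by rewrite ltr0n.
have nn : (n%:R : R) != 0 by rewrite gt_eqF.
have -> : (1 + beta) / 2 + r%:R - alpha = t / 2 by rewrite /t; field.
have -> : (n%:R : R) `^ (alpha - (1 + beta) / 2) = n%:R ^+ r * n%:R `^ (- t / 2).
  rewrite -powR_mulrn ?ltW// -powRD ?nn ?implybT//; congr (_ `^ _).
  by rewrite /t; field.
have S : Num.sqrt ((2 * n%:R) `^ (- t) / t) <=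
    2 `^ (- t / 2) * n%:R `^ (- t / 2) * (2 * Num.sqrt G).
  rewrite sqrtrM ?powR_ge0// -powR12_sqrt ?powR_ge0// -powRrM powRM//.
  rewrite ler_wpM2l ?mulr_ge0 ?powR_ge0//.
  have -> : 2 * Num.sqrt G = Num.sqrt (4 * G).
    rewrite sqrtrM// (_ : 4 = 2 ^+ 2) ?sqrtr_sqr ?ger0_norm//; ring.
  by rewrite ler_wsqrtr// lower_gamma_ge.
have B : 2 `^ (- t / 2) <= ((1 + r%:R) / 2) `^ (t / 2) :> R.
  rewrite mulNr powRN -powR_inv1 ?powR_ge0// powRAC powR_inv1//.
  apply: ge0_ler_powR; rewrite ?nnegrE; [lra|lra| |].
    by rewrite divr_ge0// addr_ge0.
  by rewrite ler_pdivlMr// mulVf// lerDl.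
have C : 2 ^+ r.+1 * r.+1%:R * 2 <= 4 ^+ (1 + r) :> R.
  rewrite -!natrX -!natrM ler_nat add1n (_ : 4 = 2 * 2)%N// expnMn -mulnA leq_mul2l.
  apply/orP; right; elim: r {S B t t0 G} => // k IH; rewrite expnS.
  by rewrite (leq_trans _ (leq_mul (leqnn 2) IH))// mulnA leq_mul2r /= mul2n -addnn addSn ltnS leq_addl.
apply: le_trans (ler_wpM2l _ S) _.
  by rewrite !mulr_ge0 ?invr_ge0 ?exprn_ge0.
rewrite [leLHS](_ : _ = n%:R ^+ r / r`!%:R * n%:R `^ (- t / 2) * Num.sqrt G *
  ((2 ^+ r.+1 * r.+1%:R * 2) * 2 `^ (- t / 2))); last by ring.
rewrite [leRHS](_ : _ = n%:R ^+ r / r`!%:R * n%:R `^ (- t / 2) * Num.sqrt G *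
  (4 ^+ (1 + r) * ((1 + r%:R) / 2) `^ (t / 2))); last by ring.
rewrite ler_wpM2l ?mulr_ge0 ?invr_ge0 ?exprn_ge0 ?powR_ge0 ?sqrtr_ge0//.
by rewrite ler_pM ?mulr_ge0 ?exprn_ge0 ?powR_ge0.
Qed.

(** * Large and small atoms together *)

Lemma c_r_ge0 (R : realType) (r : nat) : 0 <= c_r R r.
Proof.
rewrite /c_r; case: ifP => _; first exact: expR_ge0.
by rewrite divr_ge0 ?sqrtr_ge0// mulr_ge0 ?expR_ge0 ?addr_ge0.
Qed.

(** An upper bound for a cardinality is nonnegative; this sign is what the
    Cauchy-Schwarz step requires of [l]. *)
Lemma counting_bound_ge0 (R : realType) (A : choiceType) (p : A -> R)
    (alpha : R) (l : R -> R) :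
  (forall eps : R, 0 < eps <= 1 ->
      (counting_function p eps <= (eps `^ (- alpha) * l (1 / eps))%:E)%E) ->
  forall u, 1 <= u -> 0 <= l u.
Proof.
move=> nu_le u u1; have u0 : 0 < u by rewrite (lt_le_trans _ u1).
have := nu_le u^-1; rewrite invr_gt0 u0 invf_le1// => /(_ u1).
rewrite div1r invrK => /(le_trans _) H.
have : (0%:E <= (u^-1 `^ (- alpha) * l u)%:E)%E.
  by apply: H; rewrite /counting_function /counting; case: ifPn; rewrite ?lee_fin ?leey.
by rewrite lee_fin pmulr_rge0// powR_gt0 ?invr_gt0.
Qed.

Theorem corollary2p3 (R : realType) (dA : measure_display)
    (A : measurableType dA)
    (A_countable : countable [set: A])
    (A_discrete : forall B : set A, measurable B)
    (p : A -> R) (p_distr : is_distribution p)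
    (p_infinite : infinite_set (dist_support p))
    (alpha : R) (alpha01 : 0 <= alpha <= 1)
    (l : R -> R) (l_sv : slowly_varying l)
    (nu_le : forall eps : R, 0 < eps <= 1 ->
      (counting_function p eps <= (eps `^ (- alpha) * l (1 / eps))%:E)%E)
    (n : nat) (n_ge2 : (2 <= n)%N)
    (d : measure_display) (T : measurableType d) (P : probability T R)
    (X : 'I_n -> {RV P >-> A}) (X_iid : iid_with_law X p)
    (r : nat) (r_le : (r <= n - 1)%N)
    (beta : R) (beta01 : 0 < beta < 1)
    (beta_gt : 2 * (alpha - r%:R) - 1 < beta) :
  ('E_P[occupancy_mass p X r]
   <= (c_r R r * n%:R `^ (alpha - 1) * l n%:R)%:E
      + (c2 alpha beta r * n%:R `^ (alpha - (1 + beta) / 2))%:E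
        * ell_circ l beta n%:R)%E.
Proof.
have [p01 _] := p_distr.
have p_ge0 a : 0 <= p a by have /andP[] := p01 a.
have A_infinite : infinite_set [set: A].
  by apply: contra_not p_infinite; exact: sub_finite_set.
have n_gt0 : (0 < n)%N by apply: leq_trans n_ge2.
have r_le_n : (r <= n)%N by rewrite (leq_trans r_le)// leq_subr.
have n0 : (0 : R) < n%:R by rewrite ltr0n.
have n1 : (1 : R) <= n%:R by rewrite ler1n.
have [ml _] := l_sv.
have l_ge0 := counting_bound_ge0 nu_le.
have t_gt0 : 0 < 1 + beta + 2 * (r%:R - alpha) by lra.
set b : R := n%:R ^+ r / r`!%:R.
have b_ge0 : 0 <= b by rewrite divr_ge0 ?exprn_ge0.
rewrite (expectation_occupancy_mass A_discrete X_iid)//.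
(* The constant b comes from 'C(n, r) <= n ^ r / r`!; on the small atoms the factor
   (1 - p a) ^ (n - r) is bounded by 1. *)
pose large a : R := c_r R r / n%:R * (a \in [set a | n%:R^-1 <= p a])%:R.
pose small a : R := if p a < n%:R^-1 then b * p a ^+ r.+1 else 0.
have small_ge0 a : 0 <= small a by rewrite /small; case: ifP => // _; rewrite mulr_ge0 ?exprn_ge0.
have large_ge0 a : 0 <= large a.
  by rewrite mulr_ge0// divr_ge0 ?c_r_ge0.
apply: (@le_trans _ _ (\esum_(a in [set: A]) ((large a)%:E + (small a)%:E))%E).
  apply: le_esum => a _; rewrite -EFinD lee_fin /large /small.
  have [pa|pa] := ltP (p a) n%:R^-1.
    rewrite memNset ?mulr0 ?add0r; last by rewrite /= leNgt pa.
    apply: ler_pM => //; [| exact: bin_le_exp|].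
      by rewrite mulr_ge0 ?exprn_ge0// subr_ge0; have /andP[] := p01 a.
    rewrite ler_piMr ?exprn_ge0// exprn_ile1// ?gerBl// subr_ge0.
    by have /andP[] := p01 a.
  rewrite mem_set// mulr1 addr0.
  exact: mass_term_le_c_r.
rewrite esumD; [|by move=> a _; rewrite lee_fin|by move=> a _; rewrite lee_fin].
apply: leeD.
  have -> : c_r R r * n%:R `^ (alpha - 1) * l n%:R =
      c_r R r / n%:R * (n%:R `^ alpha * l n%:R).
    by rewrite powRB ?(gt_eqF n0) ?implybT// powRr1 ?ltW//; field; rewrite (gt_eqF n0).
  apply: esum_indicator_le; first by rewrite divr_ge0 ?c_r_ge0.
  have := nu_le n%:R^-1; rewrite invr_gt0 n0 invf_le1// => /(_ n1).
  have -> : (n%:R^-1 : R) `^ (- alpha) = n%:R `^ alpha.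
    by rewrite -(powR_inv1 (ltW n0)) -powRrM mulN1r opprK.
  by rewrite div1r invrK.
have K_ge0 : 0 <= b * (2 ^+ r.+1 * r.+1%:R) by rewrite !mulr_ge0 ?exprn_ge0.
apply: le_trans (esum_small_atoms_le r A_countable A_infinite p_ge0 ml nu_le b_ge0 n1) _.
apply: le_trans (tail_integral_le ml l_ge0 n1 K_ge0 t_gt0) _.
apply: lee_wpmul2r; first exact: sqrte_ge0.
by rewrite lee_fin constant_le.
Qed.
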